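(* Let $X$ be a Banach space and let $0\le\nu\le1$. Then $$H_\nu(X,B)\le(1-\delta_B(X))^{\nu}+(1-\delta_B(X))^{1-\nu}.$$
   Context: $S_X$ is the unit sphere of $X$. For $x,y\in X$, $x\perp_B y$ (Birkhoff orthogonality) means $\|x+\lambda y\|\ge\|x\|$ for all real $\lambda$. For $0\le\nu\le1$, $$H_\nu(X,B)=\sup\left\{\frac{\|x+y\|^{\nu}\|x-y\|^{1-\nu}+\|x+y\|^{1-\nu}\|x-y\|^{\nu}}{2}:\ x,y\in S_X,\ x\perp_B y\right\},$$ and $$\delta_B(X)=\inf\left\{1-\frac{\|x+y\|}{2}:\ x,y\in S_X,\ x\perp_B y\right\}.$$ *)

(* Defs.v *)
From HB Require Import structures.
From mathcomp Require Import all_boot all_order all_algebra.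
From mathcomp Require Import all_classical all_reals all_analysis.
Set Implicit Arguments.
Unset Strict Implicit.
Unset Printing Implicit Defensive.
Import Order.TTheory GRing.Theory Num.Theory.
Import numFieldNormedType.Exports.
Local Open Scope classical_set_scope.
Local Open Scope ring_scope.

Definition unit_sphere (R : realType) (X : normedModType R) : set X :=
  [set x | `|x| = 1].

Definition birkhoff_orthogonal (R : realType) (X : normedModType R)
    (x y : X) : Prop :=
  forall lambda : R, `|x| <= `|x + lambda *: y|.

(* Both index sets below are empty when X has dimension at most 1; [sup] and
   [inf] on the reals then take their default value 0. Otherwise they are
   nonempty and bounded, so these are the true supremum and infimum. *)

Definition H_B (R : realType) (X : normedModType R) (nu : R) : R :=
  sup [set r | exists x y : X,
    [/\ unit_sphere x, unit_sphere y, birkhoff_orthogonal x y &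
      r = (`|x + y| `^ nu * `|x - y| `^ (1 - nu)
           + `|x + y| `^ (1 - nu) * `|x - y| `^ nu) / 2]].

Definition delta_B (R : realType) (X : normedModType R) : R :=
  inf [set r | exists x y : X,
    [/\ unit_sphere x, unit_sphere y, birkhoff_orthogonal x y &
      r = 1 - `|x + y| / 2]].

(* Main.v *)
(* Every admissible pair satisfies |x + y| <= 2 (1 - delta_B X) by definition of
   the infimum, and |x - y| <= 2 by the triangle inequality; substituting both
   bounds into the mean, the powers of 2 combine to 2 ^ (nu + (1 - nu)) = 2. *)
Require Import Defs.
From HB Require Import structures.
From mathcomp Require Import all_boot all_order all_algebra.
From mathcomp Require Import all_classical all_reals all_analysis.
From mathcomp Require Import lra.
Set Implicit Arguments.
Unset Strict Implicit.
Unset Printing Implicit Defensive.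
Import Order.TTheory GRing.Theory Num.Theory.
Import numFieldNormedType.Exports.
Local Open Scope classical_set_scope.
Local Open Scope ring_scope.

Lemma norm_add_le_delta_B (R : realType) (X : normedModType R) (x y : X) :
  unit_sphere x -> unit_sphere y -> birkhoff_orthogonal x y ->
  `|x + y| <= 2 * (1 - delta_B X).
Proof.
move=> x1 y1 xy.
suff : delta_B X <= 1 - `|x + y| / 2 by move=> ?; lra.
apply: ge_inf; last by exists x, y.
(* [ge_inf] needs a lower bound of the set: 0 is one, by the triangle inequality on the unit
   sphere. *)
exists 0 => _ [u [v [u1 v1 _ ->]]].
rewrite /unit_sphere /= in u1 v1.
have := ler_normD u v; rewrite u1 v1 => ?; lra.
Qed.

(** Since [p + q = 1], the right side splits as (2d)^p 2^q, and each factor is bounded by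
    monotonicity of powers. *)
Lemma powR_mul_le_double (R : realType) (a b d p q : R) :
  0 <= p -> 0 <= q -> p + q = 1 -> 0 <= a -> 0 <= b -> 0 <= d ->
  a <= 2 * d -> b <= 2 -> a `^ p * b `^ q <= 2 * d `^ p.
Proof.
move=> p0 q0 pq a0 b0 d0 ad b2.
have -> : 2 * d `^ p = (2 * d) `^ p * 2 `^ q.
  rewrite powRM// mulrAC -powRD ?pq ?powRr1//.
  by rewrite oner_eq0.
by rewrite ler_pM ?powR_ge0// ge0_ler_powR// nnegrE// mulr_ge0.
Qed.

Theorem theorem3p3 (R : realType) (X : completeNormedModType R) (nu : R)
    (hnu0 : 0 <= nu) (hnu1 : nu <= 1) :
  H_B X nu <= (1 - delta_B X) `^ nu + (1 - delta_B X) `^ (1 - nu).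
Proof.
set S := [set r | exists x y : X, [/\ unit_sphere x, unit_sphere y,
  birkhoff_orthogonal x y & r = (`|x + y| `^ nu * `|x - y| `^ (1 - nu)
    + `|x + y| `^ (1 - nu) * `|x - y| `^ nu) / 2]].
rewrite /H_B -/S.
have [->|/set0P S0] := eqVneq S set0.
  (* With no admissible pair the supremum is 0, and [powR] is nonnegative whatever the sign of its
     base. *)
  by rewrite sup0 addr_ge0 ?powR_ge0.
apply: ge_sup => // _ [x [y [x1 y1 xy ->]]].
have ad := norm_add_le_delta_B x1 y1 xy.
have b2 : `|x - y| <= 2.
  by rewrite (le_trans (ler_normB _ _))// x1 y1.
have d0 : 0 <= 1 - delta_B X by have := normr_ge0 (x + y) => ?; lra.
have nu1 : 0 <= 1 - nu by rewrite subr_ge0.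
(* The two summands of the mean differ only by swapping the exponents [nu] and [1 - nu]; halving
   cancels the factor 2 of each bound. *)
have := powR_mul_le_double hnu0 nu1 (subrKC _ _) (normr_ge0 _)
  (normr_ge0 _) d0 ad b2.
have := powR_mul_le_double nu1 hnu0 (subrK _ _) (normr_ge0 _)
  (normr_ge0 _) d0 ad b2.
lra.
Qed.
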